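(* Let $\kappa$ be an algebraically closed field and let $m,d,r$ be positive integers with $m\leq r\leq\binom{d+m}{m}$. Then $$u_r(d,m)\geq H'_{r-(m-1)}(d,m).$$
   Context: Let $S_d(m,\kappa)$ be the space of homogeneous polynomials of degree $d$ in $\kappa[x_0,\dots,x_m]$ (together with $0$). For $m\leq r\leq\binom{m+d}{d}$ define $$u_r(d,m):=\max\{|V(W)| : W\subseteq S_d(m,\kappa)\text{ a linear subspace},\ \dim(W)=r,\ \dim(V(W))=0\},$$ where $V(W)\subseteq\mathbb{P}^m(\kappa)$ is the common zero set of $W$ and $|V(W)|$ is its number of points (counted without multiplicity); here the condition $\dim(V(W))=0$ means that $V(W)$ is finite, the empty set being allowed. Let $\Omega'(d,m)$ be the set of tuples $(\alpha_1,\dots,\alpha_{m+1})\in\mathbb{Z}_{\geq 0}^{m+1}$ with $\sum_{i=1}^{m+1}\alpha_i=d$ and $d\notin\{\alpha_2,\dots,\alpha_m\}$. It has $\binom{m+d}{d}-(m-1)$ elements; order it lexicographically and let $\omega'_r(d,m)$ be its $r$-th largest element. If $\omega'_r(d,m)=(\alpha_1,\dots,\alpha_{m+1})$, define $$H'_r(d,m):=\alpha_1d^{m-1}+\alpha_2d^{m-2}+\dots+\alpha_m=\sum_{i=1}^m\alpha_i d^{m-i}.$$ *)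

(* Defs.v *)
From mathcomp Require Import all_boot all_order all_algebra.
From mathcomp Require Import finmap mpoly.
From mathcomp Require Import boolp classical_sets functions cardinality.

Set Implicit Arguments.
Unset Strict Implicit.
Unset Printing Implicit Defensive.

Import GRing.Theory.

Local Open Scope classical_set_scope.
Local Open Scope ring_scope.

(* The points of P^m(K) are the lines through the origin of K^(m+1). *)
Definition projective_space (K : fieldType) (m : nat) : choiceType :=
  {L : {vspace 'rV[K]_m.+1} | \dim L == 1%N}.

(* S_d(m, K) is the library's vector space [dhomog m.+1 K d], which contains
   the zero polynomial. *)
Definition zero_locus (K : fieldType) (m d : nat)
    (W : {vspace dhomog m.+1 K d}) : set (projective_space K m) :=
  [set L : projective_space K m | forall f : dhomog m.+1 K d, f \in W ->
     forall v : 'rV[K]_m.+1, v \in sval L ->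
       (f : {mpoly K[m.+1]}).@[fun i => v 0 i] = 0].

(* The condition dim V(W) = 0 means that V(W) is finite, possibly empty; without
   it [fset_set] would return the junk value fset0. *)
Definition zero_counts (K : fieldType) (r d m : nat) : set nat :=
  [set n | exists W : {vspace dhomog m.+1 K d},
     [/\ \dim W = r, finite_set (zero_locus W) &
         n = #|` fset_set (zero_locus W) |%fset]].

Definition is_maximum (A : set nat) (u : nat) : Prop :=
  A u /\ forall n, A n -> (n <= u)%N.

(* The default value 0 is only taken when there is no maximum. *)
Definition u_max (K : fieldType) (r d m : nat) : nat :=
  xget 0%N [set u | is_maximum (zero_counts K r d m) u].

(* With 0-based indices, alpha_2, ..., alpha_m are the entries of index i with
   0 < i < m. The entries are at most d since they are nonnegative integers of
   sum d. *)
Definition Omega' (d m : nat) : {set (m.+1).-tuple 'I_d.+1} :=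
  [set a : (m.+1).-tuple 'I_d.+1 |
     ((\sum_(i < m.+1) tnth a i)%N == d) &&
     [forall i : 'I_m.+1, (0 < i < m)%N ==> (tnth a i != d :> nat)]]%SET.

Definition lex_ge (d m : nat) : rel ((m.+1).-tuple 'I_d.+1) :=
  fun a b => ((b : (m.+1).-tuplelexi 'I_d.+1) <= a)%O.

(* The r-th largest element of Omega', with r counted from 1; the default value
   of [nth] is only taken when there are fewer than r elements. *)
Definition omega' (r d m : nat) : (m.+1).-tuple 'I_d.+1 :=
  nth [tuple ord0 | i < m.+1] (sort (@lex_ge d m) (enum (Omega' d m))) r.-1.

Definition H' (r d m : nat) : nat :=
  (\sum_(i < m) tnth (omega' r d m) (widen_ord (leqnSn m) i)
     * d ^ (m - i.+1))%N.

(* Main.v *)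
Require Import Defs.
From mathcomp Require Import all_boot all_order all_algebra.
From mathcomp Require Import finmap mpoly closed_field.
From mathcomp Require Import boolp classical_sets cardinality.

(* Lower bound. Fix distinct scalars a_0, ..., a_d and attach to an exponent
   vector b of weight d the form
     F_b = prod_(i <= m) prod_(j < b_i) (x_i - a_j x_(m+1)) * x_(m+1)^(b_(m+1)).
   Evaluation at the points (a_(b_1) : ... : a_(b_m) : 1) shows that the F_b are
   linearly independent. Let W be spanned by the forms of the exponents d e_i
   with 1 < i <= m, which are those outside Omega', and of the r - (m - 1)
   largest elements of Omega', the first of which is d e_1. The forms of the
   d e_i cut out the grid of the points (a_(c_1) : ... : a_(c_m) : 1) with all
   c_i < d, and F_b vanishes at such a point unless b_i <= c_i for all i <= m.
   Reading c_1 ... c_m as the base d digits of a number n, this cannot happen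
   for n < H', since the value of the digits b_1 ... b_m is monotone in the
   lexicographic order.

   Existence of the maximum. The number of points of a finite V(W) is bounded in
   terms of m, d and r: the coordinates in each standard chart range over a
   definable set, and by quantifier elimination a finite definable subset of an
   algebraically closed field has a number of elements that is bounded
   independently of the parameters. *)

Set Implicit Arguments.
Unset Strict Implicit.
Unset Printing Implicit Defensive.

Import GRing.Theory.

(** * Uniform finiteness of definable sets over an algebraically closed field *)

Section UniformFiniteness.

Local Open Scope ring_scope.

Variable K : closedFieldType.

Lemma closed_field_roots (p : {poly K}) :
  p != 0 -> exists2 s : seq K, (size s < size p)%N & forall x, root p x -> x \in s.
Proof.
move=> p0; have [s Dp] := closed_field_poly_normal p.
have l0 : lead_coef p != 0 by rewrite lead_coef_eq0.
exists s => [|x]; last by rewrite Dp rootZ // root_prod_XsubC.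
by rewrite Dp size_scale // size_prod_XsubC.
Qed.

Lemma closed_field_infinite (s : seq K) : exists x, x \notin s.
Proof.
(* The product vanishes on [s], so [p] is 1 there and its roots lie outside [s]; the factor ['X]
   keeps [p] nonconstant when [s] is empty. *)
pose p : {poly K} := \prod_(z <- s) ('X - z%:P) * 'X + 1.
have sz : size (\prod_(z <- s) ('X - z%:P) * 'X : {poly K}) = (size s).+2.
  by rewrite size_mulX ?size_prod_XsubC // -size_poly_eq0 size_prod_XsubC.
have szp : size p = (size s).+2 by rewrite size_polyDl sz // size_poly1.
have [x /rootP px0] : exists x, root p x by apply/closed_rootP; rewrite szp.
exists x; apply/negP; rewrite -root_prod_XsubC => /rootP xs0.
by move/eqP: px0; rewrite /p hornerD hornerM xs0 mul0r add0r hornerC oner_eq0.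
Qed.

Lemma closed_field_uniq_seq n : exists2 s : seq K, uniq s & size s = n.
Proof.
elim: n => [|n [s us ss]]; first by exists [::].
have [x xs] := closed_field_infinite s.
by exists (x :: s); rewrite /= ?xs ?ss.
Qed.

(** The degree in the variable [i] is controlled by the shape of the term alone, so [D] is chosen
    before the environment; [rterm] excludes inverses. *)
Lemma term_univariate (t : GRing.term K) (i : nat) : GRing.rterm t ->
  exists D, forall e, exists2 p : {poly K}, (size p <= D)%N &
    forall x, GRing.eval (set_nth 0 e i x) t = p.[x].
Proof.
elim: t => [j|c|n|t1 IH1 t2 IH2|t IH|t IH n|t1 IH1 t2 IH2|t IH|t IH n] //=.
- move=> _; exists 2 => e; have [->|ji] := eqVneq j i.
    by exists 'X => [|x]; rewrite ?size_polyX // hornerX nth_set_nth /= eqxx.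
  exists (e`_j)%:P => [|x]; first exact: leq_trans (size_polyC_leq1 _) _.
  by rewrite hornerC nth_set_nth /= (negbTE ji).
- by move=> _; exists 1%N => e; exists c%:P => [|x]; rewrite ?size_polyC_leq1 ?hornerC.
- move=> _; exists 1%N => e; exists (n%:R)%:P => [|x]; rewrite ?size_polyC_leq1 //.
  by rewrite hornerC.
- case/andP=> /IH1[D1 H1] /IH2[D2 H2]; exists (maxn D1 D2) => e.
  have [p1 s1 E1] := H1 e; have [p2 s2 E2] := H2 e.
  exists (p1 + p2) => [|x]; last by rewrite hornerD E1 E2.
  by apply: leq_trans (size_polyD _ _) _; rewrite geq_max !leq_max s1 s2 orbT.
- move=> /IH[D H]; exists D => e; have [p s E] := H e.
  by exists (- p) => [|x]; rewrite ?size_polyN // hornerN E.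
- move=> /IH[D H]; exists D => e; have [p s E] := H e.
  exists (p *+ n) => [|x]; last by rewrite hornerMn E.
  by rewrite -scaler_nat; apply: leq_trans (size_scale_leq _ _) s.
- case/andP=> /IH1[D1 H1] /IH2[D2 H2]; exists (D1 + D2)%N => e.
  have [p1 s1 E1] := H1 e; have [p2 s2 E2] := H2 e.
  exists (p1 * p2) => [|x]; last by rewrite hornerM E1 E2.
  apply: leq_trans (size_polyMleq _ _) _.
  by apply: leq_trans (leq_pred _) _; rewrite leq_add.
- move=> /IH[D H]; exists (D * n).+1 => e; have [p s E] := H e.
  exists (p ^+ n) => [|x]; last by rewrite horner_exp E.
  apply: leq_trans (size_poly_exp_leq _ _) _.
  by rewrite ltnS leq_mul2r (leq_trans (leq_pred _) s) orbT.
Qed.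

(** An equation p1 = p2 holds identically or fails off the roots of p1 - p2, whose number is bounded
    by the degrees; connectives merge the exceptional lists. *)
Lemma qf_cofinitely_constant (f : GRing.formula K) (i : nat) :
  GRing.qf_form f && GRing.rformula f ->
  exists D, forall e, exists2 s : seq K, (size s <= D)%N &
    exists b : bool, forall x, x \notin s ->
      (GRing.holds (set_nth 0 e i x) f <-> b).
Proof.
elim: f => [b|t1 t2|t|f1 IH1 f2 IH2|f1 IH1 f2 IH2|f1 IH1 f2 IH2|f IH|j f IH|j f IH] //=;
  rewrite ?andbF //.
- by exists 0%N => e; exists [::] => //; exists b.
- case/andP=> /(term_univariate i)[D1 H1] /(term_univariate i)[D2 H2].
  exists (maxn D1 D2) => e.
  have [p1 s1 E1] := H1 e; have [p2 s2 E2] := H2 e.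
  have [p0|p0] := eqVneq (p1 - p2) 0.
    exists [::] => //; exists true => x _; rewrite E1 E2; split=> // _.
    by move/eqP: p0; rewrite subr_eq0 => /eqP->.
  have [s ss rs] := closed_field_roots p0; exists s.
    apply: leq_trans (ltnW ss) _; apply: leq_trans (size_polyD _ _) _.
    by rewrite size_polyN geq_max !leq_max s1 s2 orbT.
  exists false => x xs; split=> // Ex; case/negP: xs; apply: rs.
  by rewrite rootE hornerD hornerN subr_eq0 -E1 -E2 Ex.
- case/andP=> /andP[q1 q2] /andP[r1 r2].
  have [|D1 H1] := IH1; first by rewrite q1 r1.
  have [|D2 H2] := IH2; first by rewrite q2 r2.
  exists (D1 + D2)%N => e.
  have [s1 z1 [b1 E1]] := H1 e; have [s2 z2 [b2 E2]] := H2 e.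
  exists (s1 ++ s2); first by rewrite size_cat leq_add.
  exists (b1 && b2) => x; rewrite mem_cat negb_or => /andP[/E1-> /E2->].
  by split=> [[-> ->]|/andP].
- case/andP=> /andP[q1 q2] /andP[r1 r2].
  have [|D1 H1] := IH1; first by rewrite q1 r1.
  have [|D2 H2] := IH2; first by rewrite q2 r2.
  exists (D1 + D2)%N => e.
  have [s1 z1 [b1 E1]] := H1 e; have [s2 z2 [b2 E2]] := H2 e.
  exists (s1 ++ s2); first by rewrite size_cat leq_add.
  exists (b1 || b2) => x; rewrite mem_cat negb_or => /andP[/E1-> /E2->].
  by split=> /orP.
- case/andP=> /andP[q1 q2] /andP[r1 r2].
  have [|D1 H1] := IH1; first by rewrite q1 r1.
  have [|D2 H2] := IH2; first by rewrite q2 r2.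
  exists (D1 + D2)%N => e.
  have [s1 z1 [b1 E1]] := H1 e; have [s2 z2 [b2 E2]] := H2 e.
  exists (s1 ++ s2); first by rewrite size_cat leq_add.
  exists (b1 ==> b2) => x; rewrite mem_cat negb_or => /andP[/E1-> /E2->].
  by split=> /implyP.
- move=> /IH[D H]; exists D => e; have [s z [b E]] := H e.
  exists s => //; exists (~~ b) => x /E->.
  by split=> /negP.
Qed.

(** A cardinality bound for a predicate that need not be decidable; the list may contain further
    elements. *)
Definition listable (T : eqType) (P : T -> Prop) (B : nat) :=
  exists2 s : seq T, (size s <= B)%N & forall x, P x -> x \in s.

Lemma listable_leq (T : eqType) (P : T -> Prop) B B' :
  (B <= B')%N -> listable P B -> listable P B'.
Proof. by move=> le_B [s ss Ps]; exists s => //; apply: leq_trans le_B. Qed.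

(* Uniform finiteness (elimination of the quantifier "there exist infinitely
   many"): quantifier elimination makes f quantifier free, and such a formula
   has constant truth value in x outside of a bounded number of points. *)
Lemma uniform_finiteness (f : GRing.formula K) (i : nat) :
  GRing.rformula f ->
  exists D, forall e (P := fun x => GRing.holds (set_nth 0 e i x) f),
    (exists n, listable P n) -> listable P D.
Proof.
move=> rf; pose qf := GRing.quantifier_elim (@ClosedFieldQE.ex_elim K) f.
have wf := @ClosedFieldQE.wf_ex_elim K.
have ok := ClosedFieldQE.holds_ex_elim (@GRing.solve_monicpoly K).
have qfP e : GRing.holds e f <-> GRing.holds e qf.
  have Q := GRing.quantifier_elim_rformP wf ok e rf.
  have Q' := GRing.qf_evalP e (proj1 (andP (GRing.quantifier_elim_wf wf rf))).
  by split=> [/Q /Q'|/Q' /Q].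
have [D HD] := qf_cofinitely_constant i (GRing.quantifier_elim_wf wf rf).
exists D => e P [n [l _ lP]]; have [s sz [b Eb]] := HD e.
exists s => // x Px; apply: contraPT Px => xs.
case: b Eb => Eb; last by move=> /qfP/(Eb _ xs).
(* Here [b] is true, so [P] holds everywhere off [s]; a point outside both [s] and the finite list
   [l] of solutions is a contradiction. *)
have [y] := closed_field_infinite (l ++ s).
rewrite mem_cat negb_or => /andP[yl /Eb[_ /(_ isT) /qfP Py]].
by rewrite (lP _ Py) in yl.
Qed.

(** Stated for predicates on environments, so that formulas are obtained from closure properties
    instead of being written out. *)
Definition definable (P : seq K -> Prop) :=
  exists2 f : GRing.formula K, GRing.rformula f & forall e, GRing.holds e f <-> P e.

Definition term_function (g : seq K -> K) :=
  exists2 t : GRing.term K, GRing.rterm t & forall e, GRing.eval e t = g e.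

Lemma definable_eq g1 g2 : term_function g1 -> term_function g2 ->
  definable (fun e => g1 e = g2 e).
Proof.
move=> [t1 r1 E1] [t2 r2 E2]; exists (t1 == t2)%T => [|e] /=; first by rewrite r1.
by rewrite E1 E2.
Qed.

Lemma definable_and P Q : definable P -> definable Q ->
  definable (fun e => P e /\ Q e).
Proof.
move=> [f rf Ef] [g rg Eg]; exists (f /\ g)%T => [|e] /=; first by rewrite rf.
by rewrite Ef Eg.
Qed.

Lemma definable_forall (I : finType) (P : I -> seq K -> Prop) :
  (forall i, definable (P i)) -> definable (fun e => forall i, P i e).
Proof.
move=> dP.
suff [f rf Ef] : definable (fun e => forall i, i \in enum I -> P i e).
  exists f => // e; rewrite Ef; split=> [H i|H i _ //].
  by apply: H; rewrite mem_enum.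
elim: (enum I) => [|i s [f rf Ef]]; first by exists (GRing.Bool true).
have [g rg Eg] := dP i; exists (g /\ f)%T => [|e] /=; first by rewrite rg.
rewrite Ef Eg; split=> [[Pi Ps] j|H].
  by rewrite inE => /predU1P[->//|/Ps].
by split=> [|j js]; apply: H; rewrite inE ?eqxx // js orbT.
Qed.

(** A block of quantifiers, used below to quantify over all coordinates of a point at once. *)
Lemma definable_exists (I : seq nat) P : definable P ->
  definable (fun e => exists2 e' : seq K,
    {in [predC I], GRing.same_env e e'} & P e').
Proof.
move=> [f rf Ef]; exists (foldr GRing.Exists f I) => [|e].
  by elim: I => //=.
by rewrite -GRing.foldExistsP; split=> -[e' ee' /Ef fe']; exists e'.
Qed.

Lemma term_function_const c : term_function (fun=> c).
Proof. by exists c%:T%T. Qed.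

Lemma term_function_var i : term_function (fun e => e`_i).
Proof. by exists (GRing.Var K i). Qed.

Lemma term_function_mul g1 g2 : term_function g1 -> term_function g2 ->
  term_function (fun e => g1 e * g2 e).
Proof.
move=> [t1 r1 E1] [t2 r2 E2]; exists (t1 * t2)%T => [|e] /=; first by rewrite r1.
by rewrite E1 E2.
Qed.

Lemma term_function_exp g n : term_function g -> term_function (fun e => g e ^+ n).
Proof.
by move=> [t r E]; exists (t ^+ n)%T => [|e] //=; rewrite E.
Qed.

Lemma term_function_sum (I : Type) (s : seq I) (g : I -> seq K -> K) :
  (forall i, term_function (g i)) -> term_function (fun e => \sum_(i <- s) g i e).
Proof.
move=> tg; elim: s => [|i s [t r E]].
  by exists (GRing.Const (0 : K)) => // e; rewrite big_nil.
have [t' r' E'] := tg i; exists (t' + t)%T => [|e] /=; first by rewrite r'.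
by rewrite big_cons E E'.
Qed.

Lemma term_function_prod (I : Type) (s : seq I) (g : I -> seq K -> K) :
  (forall i, term_function (g i)) -> term_function (fun e => \prod_(i <- s) g i e).
Proof.
move=> tg; elim: s => [|i s [t r E]].
  by exists (GRing.Const (1 : K)) => // e; rewrite big_nil.
have [t' r' E'] := tg i; exists (t' * t)%T => [|e] /=; first by rewrite r'.
by rewrite big_cons E E'.
Qed.

Lemma term_function_meval n (p : {mpoly K[n]}) :
  term_function (fun e => p.@[fun i => e`_i]).
Proof.
suff [t r E] : term_function (fun e =>
    \sum_(m <- msupp p) p@_m * \prod_(i < n) e`_i ^+ m i).
  by exists t => // e; rewrite E mevalE.
apply: term_function_sum => m; apply: term_function_mul.
  exact: term_function_const.
apply: term_function_prod => i; apply: term_function_exp.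
exact: term_function_var.
Qed.

(** The coefficients [c] are parameters of one fixed formula, so uniform finiteness gives a single
    [D] for all systems of [r] equations in the span of the [b l]. *)
Lemma coordinate_projection_bound n r N (b : 'I_N -> {mpoly K[n]}) (k i : 'I_n) :
  exists D, forall (c : 'I_r -> 'I_N -> K)
    (P := fun t => exists x : 'I_n -> K, [/\ x k = 1, x i = t &
            forall j, (\sum_l c j l *: b l).@[x] = 0]),
    (exists B, listable P B) -> listable P D.
Proof.
(* The variables of the formula are the n coordinates of a point, then the
   value t, and then the coefficients c. *)
pose cv (j : 'I_r) (l : 'I_N) := (n.+1 + enum_rank (j, l))%N.
pose body (e : seq K) := (e`_i = e`_n /\ e`_k = 1) /\
  forall j : 'I_r, \sum_(l <- enum 'I_N) e`_(cv j l) * (b l).@[fun i => e`_i] = 0.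
have dbody : definable body.
  apply: definable_and; first apply: definable_and; try apply: definable_eq;
    do ?exact: term_function_var; do ?exact: term_function_const.
  apply: definable_forall => j; apply: definable_eq; last exact: term_function_const.
  apply: term_function_sum => l; apply: term_function_mul.
    exact: term_function_var.
  exact: term_function_meval.
have [f rf Ef] := definable_exists (iota 0 n) dbody.
have [D HD] := uniform_finiteness n rf.
exists D => c P.
(* The leading zeros are placeholders: entries below [n] are quantified and entry [n] is overwritten
   by [t]. *)
pose e := nseq n.+1 0 ++ [seq c jl.1 jl.2 | jl <- enum {: 'I_r * 'I_N}].
have eE t j l : (set_nth 0 e n t)`_(cv j l) = c j l.
  rewrite nth_set_nth /= ifN; last by rewrite gtn_eqF // ltn_addr.
  rewrite /e nth_cat size_nseq ltnNge leq_addr /= addKn.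
  rewrite (nth_map (j, l)) ?nth_enum_rank //.
  by rewrite -cardE ltn_ord.
have PE t : P t <-> GRing.holds (set_nth 0 e n t) f.
  rewrite Ef; split.
  - case=> x [xk xi xf].
    (* The first [n] entries are replaced by [x]; past the chosen length both sequences take the
       default value 0. *)
    pose e' := mkseq (fun z => if insub z is Some z' then x z' else
                 (set_nth 0 e n t)`_z) (maxn (size (set_nth 0 e n t)) n).
    have e'E (z : 'I_n) : e'`_z = x z.
      by rewrite nth_mkseq ?valK // leq_max ltn_ord orbT.
    have e'E2 z : (n <= z)%N -> e'`_z = (set_nth 0 e n t)`_z.
      move=> nz; have [zs|zs] := ltnP z (maxn (size (set_nth 0 e n t)) n).
        by rewrite nth_mkseq // insubF // ltnNge nz.
      rewrite nth_default ?size_mkseq // nth_default //.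
      exact: leq_trans (leq_maxl _ _) zs.
    exists e' => [z|].
      by rewrite inE mem_iota /= -leqNgt => nz; rewrite e'E2.
    split; first by rewrite !e'E e'E2 // xi xk nth_set_nth /= eqxx.
    move=> j; rewrite -[RHS](xf j) raddf_sum /= big_enum; apply: eq_bigr => l _.
    rewrite mevalZ e'E2 ?eE; last by rewrite /cv addSn -addnS leq_addr.
    by congr (_ * _); apply: meval_eq => z; rewrite e'E.
  - case=> e' ee' [[e'i e'k] e'f]; exists (fun i : 'I_n => e'`_i); split=> //.
      rewrite e'i -ee' ?nth_set_nth /= ?eqxx //.
      by rewrite inE mem_iota /= ltnn.
    move=> j; rewrite -[RHS](e'f j) raddf_sum /= big_enum; apply: eq_bigr => l _.
    rewrite mevalZ -ee' ?eE // inE mem_iota /= /cv add0n.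
    by rewrite -leqNgt addSn -addnS leq_addr.
move=> [B [l Bl lP]]; have [|l' Dl' l'P] := HD e.
  by exists B, l => // t /PE /lP.
by exists l' => // t /PE /l'P.
Qed.

End UniformFiniteness.

(** * Points of projective space, their generators and affine charts *)

Section ZeroLocus.

Local Open Scope ring_scope.

Variables (K : fieldType) (m d : nat).
Implicit Types (x y v : 'rV[K]_m.+1) (L : projective_space K m).
Implicit Types (W : {vspace dhomog m.+1 K d}).

Lemma dhomog_meval_scale n (f : dhomog n K d) (a : K) (x : 'I_n -> K) :
  (f : {mpoly K[n]}).@[fun i => a * x i] = a ^+ d * (f : {mpoly K[n]}).@[x].
Proof.
rewrite !mevalE mulr_sumr !big_seq; apply: eq_bigr => u /(dhomogP _ _ _ (valP f)) /= Du.
rewrite mulrCA; congr (_ * _); rewrite -[in a ^+ d]Du mdegE -prodrXr -big_split /=.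
by apply: eq_bigr => i _; rewrite exprMn.
Qed.

Lemma mpoly_of_dhomogZ n (a : K) (f : dhomog n K d) :
  (a *: f : dhomog n K d) = a *: (f : {mpoly K[n]}) :> {mpoly K[n]}.
Proof. exact: linearZ. Qed.

Definition line_point x (x0 : x != 0) : projective_space K m :=
  exist _ <[x]>%VS (introT eqP (etrans (dim_vline x) (congr1 nat_of_bool x0))).

(** By homogeneity, vanishing at a generator implies vanishing on the whole line. *)
Lemma zero_locus_line_point W x (x0 : x != 0) :
  zero_locus W (line_point x0) <->
  forall f : dhomog m.+1 K d, f \in W -> (f : {mpoly K[m.+1]}).@[fun i => x 0 i] = 0.
Proof.
split=> [H f fW|H f fW v /= /vlineP[a ->]]; first by apply: H => //=; exact: memv_line.
rewrite (meval_eq (v2 := fun i => a * x 0 i)) => [|i]; last by rewrite mxE.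
by rewrite dhomog_meval_scale H // mulr0.
Qed.

Lemma line_point_vpick L (x0 : vpick (sval L) != 0) : line_point x0 = L.
Proof.
apply: val_inj => /=; apply/eqP; rewrite eqEdim -memvE memv_pick.
by rewrite (eqP (valP L)) dim_vline x0.
Qed.

Lemma line_point_scale c x y (x0 : x != 0) (y0 : y != 0) :
  x = c *: y -> line_point x0 = line_point y0.
Proof.
move=> Dx; apply: val_inj => /=; apply/eqP.
by rewrite eqEdim !dim_vline x0 y0 -memvE Dx memvZ // memv_line.
Qed.

Lemma projective_vpick_neq0 L : vpick (sval L) != 0.
Proof. by rewrite vpick0 -dimv_eq0 (eqP (valP L)). Qed.

(** The function x_i / x_k on the chart x_k <> 0. The ratio is independent of the generator picked
    by [vpick]. *)
Definition affine_coordinate (k i : 'I_m.+1) L :=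
  vpick (sval L) 0 i / vpick (sval L) 0 k.

Lemma affine_coordinate_line_point k i x (x0 : x != 0) :
  affine_coordinate k i (line_point x0) = x 0 i / x 0 k.
Proof.
have := projective_vpick_neq0 (line_point x0); rewrite /affine_coordinate /=.
have /vlineP[a ->] := memv_pick <[x]>%VS.
rewrite scaler_eq0 negb_or => /andP[a0 _]; rewrite !mxE.
by rewrite invfM mulrACA mulfV // mul1r.
Qed.

Lemma affine_coordinate_inj k L L' :
    vpick (sval L) 0 k != 0 -> vpick (sval L') 0 k != 0 ->
  (forall i, affine_coordinate k i L = affine_coordinate k i L') -> L = L'.
Proof.
move=> Lk Lk' LL'.
rewrite -(line_point_vpick (projective_vpick_neq0 L)).
rewrite -(line_point_vpick (projective_vpick_neq0 L')).
apply: (line_point_scale (c := vpick (sval L) 0 k / vpick (sval L') 0 k)).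
apply/rowP => i; rewrite mxE; have := LL' i; rewrite /affine_coordinate.
by move/(canRL (divfK Lk)) => ->; rewrite -mulrA mulrC [_^-1 * _]mulrC.
Qed.

End ZeroLocus.

(** * Existence of the maximum defining u_r *)

Section ZeroCountsBounded.

Local Open Scope ring_scope.

Variables (K : closedFieldType) (m d r : nat).

(** Coordinates in a fixed basis of all forms turn [W] into a coefficient matrix, the parameter [c]
    of [coordinate_projection_bound]. *)
Lemma zero_locus_basis (W : {vspace dhomog m.+1 K d}) (x : 'I_m.+1 -> K)
    (b := vbasis {:dhomog m.+1 K d}) : \dim W = r ->
  ((forall j : 'I_r,
      (\sum_l coord b l (vbasis W)`_j *: (b`_l : {mpoly K[m.+1]})).@[x] = 0) <->
  (forall f : dhomog m.+1 K d, f \in W -> (f : {mpoly K[m.+1]}).@[x] = 0)).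
Proof.
move=> Wr.
have bE (j : 'I_r) : \sum_l coord b l (vbasis W)`_j *: (b`_l : {mpoly K[m.+1]}) =
    ((vbasis W)`_j : dhomog m.+1 K d).
  rewrite {2}(coord_vbasis (memvf (vbasis W)`_j)) raddf_sum.
  by apply: eq_bigr => l _; exact: mpoly_of_dhomogZ.
split=> [H f fW|H j]; last first.
  by rewrite bE H // vbasis_mem // mem_nth // size_tuple Wr.
rewrite (coord_vbasis fW) raddf_sum raddf_sum big1 //= => l _.
have lr : (l < r)%N by rewrite -Wr.
by rewrite [X in X.@[_]]mpoly_of_dhomogZ mevalZ -(bE (Ordinal lr)) H mulr0.
Qed.

(** A zero is encoded by a chart containing it and the positions of its affine coordinates in lists
    of length at most [D]; the number of codes is independent of [W]. *)
Lemma zero_counts_bounded :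
  exists B, forall n, zero_counts K r d m n -> (n <= B)%N.
Proof.
pose b := vbasis {:dhomog m.+1 K d}.
have [D0 HD0] := fin_all_exists (fun ki : 'I_m.+1 * 'I_m.+1 =>
  coordinate_projection_bound r (fun l : 'I_(\dim {:dhomog m.+1 K d}) =>
    (b`_l : {mpoly K[m.+1]})) ki.1 ki.2).
pose D := (\max_ki D0 ki)%N.
pose T := ('I_m.+1 * {ffun 'I_m.+1 -> 'I_D.+1})%type.
exists #|{: T}| => _ [W [Wr Zfin ->]].
pose P k i t := exists x : 'I_m.+1 -> K, [/\ x k = 1, x i = t &
  forall f : dhomog m.+1 K d, f \in W -> (f : {mpoly K[m.+1]}).@[x] = 0].
have PD (ki : 'I_m.+1 * 'I_m.+1) : listable (P ki.1 ki.2) D.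
  apply: listable_leq (leq_bigmax ki) _.
  have [|s Ds Ps] := HD0 ki (fun j l => coord b l (vbasis W)`_j); last first.
    exists s => // t [x [xk xi xW]]; apply: Ps; exists x; split=> //.
    by apply/zero_locus_basis.
  (* The uniform bound requires the projection to be finite: it is an image of points of the finite
     zero locus. *)
  have /finite_seqP[s Zs] := Zfin.
  exists (size s), [seq affine_coordinate ki.1 ki.2 L | L <- s]; rewrite ?size_map //.
  move=> t [x [xk xi /zero_locus_basis xW]].
  pose v : 'rV[K]_m.+1 := \row_i x i.
  have v0 : v != 0.
    by apply/eqP => /rowP/(_ ki.1)/eqP; rewrite !mxE xk oner_eq0.
  apply/mapP; exists (line_point v0); last first.
    by rewrite affine_coordinate_line_point !mxE xk xi divr1.
  have : zero_locus W (line_point v0).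
    apply/zero_locus_line_point => f fW.
    by rewrite (meval_eq (v2 := x)) ?xW // => i; rewrite mxE.
  by rewrite Zs.
have [l lD lP] := fin_all_exists2 PD.
pose k (L : projective_space K m) := odflt ord0 [pick k | vpick (sval L) 0 k != 0 :> K].
have kP (L : projective_space K m) : vpick (sval L) 0 (k L) != 0.
  rewrite /k; case: pickP => //= L0; case/negP: (projective_vpick_neq0 L).
  by apply/eqP/rowP => i; rewrite mxE; apply/eqP/negbFE/L0.
pose phi (L : projective_space K m) : T := (k L,
  [ffun i => inord (index (affine_coordinate (k L) i L) (l (k L, i)))]).
have ZP (L : projective_space K m) i : L \in fset_set (zero_locus W) ->
    affine_coordinate (k L) i L \in l (k L, i).
  rewrite in_fset_set // inE => LZ; apply: lP.
  exists (fun i => affine_coordinate (k L) i L); split=> //.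
    by rewrite /affine_coordinate divff ?kP.
  move=> f fW; have := (zero_locus_line_point W (projective_vpick_neq0 L)).1.
  rewrite line_point_vpick => /(_ LZ f fW) f0.
  rewrite (meval_eq (v2 := fun i => (vpick (sval L) 0 (k L))^-1 * vpick (sval L) 0 i)).
    by rewrite dhomog_meval_scale f0 mulr0.
  by move=> j; rewrite mulrC.
have phi_inj : {in fset_set (zero_locus W) &, injective phi}.
  move=> L L' LZ LZ' [kLL' /ffunP eqf].
  apply: (@affine_coordinate_inj _ _ (k L)); rewrite ?kP ?[in k L]kLL' ?kP // => i.
  have := congr1 val (eqf i); rewrite !ffunE /= !inordK ?ltnS; last 2 first.
  - by apply: leq_trans (index_size _ _) (lD _).
  - by apply: leq_trans (index_size _ _) (lD _).
  have := ZP L i LZ; have := ZP L' i LZ'; rewrite kLL' => i' i1.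
  by move/(congr1 (nth 0 (l (k L', i)))); rewrite !nth_index.
rewrite -(size_map phi) cardE; apply: uniq_leq_size => [|y _]; last exact: mem_enum.
by rewrite map_inj_in_uniq // fset_uniq.
Qed.

(** A nonempty bounded set of naturals has a maximum, so [xget] does not return its default
    value. *)
Lemma u_max_ge n : zero_counts K r d m n -> (n <= u_max K r d m)%N.
Proof.
move=> cn; have [B HB] := zero_counts_bounded.
have ex : exists n, `[< zero_counts K r d m n >] by exists n; apply/asboolP.
have ub n' : `[< zero_counts K r d m n' >] -> (n' <= B)%N by move/asboolP/HB.
suff [_ ] : is_maximum (zero_counts K r d m) (u_max K r d m) by apply.
apply: xgetPex; case: (ex_maxnP ex ub) => u /asboolP cu uP.
by exists u; split=> // n' cn'; apply: uP; apply/asboolP.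
Qed.

End ZeroCountsBounded.

(** * Base d expansions *)

Section Radix.

Variable d : nat.

(** The most significant digit comes first, and a digit may be [d] or more, as an exponent can equal
    [d]. *)
Definition radix_value (m : nat) (f : nat -> nat) :=
  \sum_(i < m) f i * d ^ (m - i.+1).

Lemma radix_valueS m f :
  radix_value m.+1 f = f 0 * d ^ m + radix_value m (fun i => f i.+1).
Proof. by rewrite /radix_value big_ord_recl /= subn1. Qed.

Lemma radix_value_leq m f g : (forall i, i < m -> f i <= g i) ->
  radix_value m f <= radix_value m g.
Proof. by move=> fg; apply: leq_sum => i _; rewrite leq_mul2r fg ?orbT. Qed.

Lemma radix_value_lt m f : (forall i, i < m -> f i < d) -> radix_value m f < d ^ m.
Proof.
elim: m f => [|m IH] f fd; first by rewrite /radix_value big_ord0.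
rewrite radix_valueS expnS; apply: (@leq_trans (f 0 * d ^ m + d ^ m)).
  by rewrite ltn_add2l IH // => i im; apply: fd.
by rewrite addnC -mulSn leq_mul2r fd ?orbT.
Qed.

(** The digits of [f] after position [k] contribute less than one unit of position [k], where [g] is
    ahead by at least one. *)
Lemma radix_value_lex m k f g : k < m -> (forall i, i < k -> f i = g i) ->
    f k < g k -> (forall i, k < i < m -> f i < d) ->
  radix_value m f < radix_value m g.
Proof.
elim: m k f g => // m IH [|k] f g km fg fgk fd; rewrite !radix_valueS; last first.
  rewrite fg // ltn_add2l; apply: (IH k) => // [i ik|i /andP[ki im]].
    by apply: fg.
  by apply: fd; rewrite !ltnS ki.
apply: (@leq_trans (f 0 * d ^ m + d ^ m)).
  by rewrite ltn_add2l radix_value_lt // => i im; apply: fd; rewrite ltnS.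
by apply: leq_trans (leq_addr _ _); rewrite addnC -mulSn leq_mul2r fgk orbT.
Qed.

Lemma radix_value_carry m : 0 < m ->
  radix_value m (fun i => if i == 0 then d else 0) = d ^ m.
Proof.
case: m => // m _; rewrite radix_valueS eqxx -expnS -[RHS]addn0; congr (_ + _).
by apply: big1 => i _; rewrite mul0n.
Qed.

Lemma radix_value_digits m n :
  radix_value m (fun i => n %/ d ^ (m - i.+1) %% d) = n %% d ^ m.
Proof.
elim: m => [|m IH]; first by rewrite /radix_value big_ord0 modn1.
rewrite radix_valueS subn1 /= -[X in _ + X]/(radix_value m _) IH.
have [->|d0] := posnP d; last first.
  have E : n = n %/ d ^ m.+1 * d ^ m.+1 + (n %/ d ^ m %% d * d ^ m + n %% d ^ m).
    rewrite {1}(divn_eq n (d ^ m)) {1}(divn_eq (n %/ d ^ m) d) mulnDl -mulnA -expnS.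
    by rewrite -addnA -divnMA -expnSr.
  rewrite [in RHS]E modnMDl [RHS]modn_small // expnS.
  apply: (@leq_trans (n %/ d ^ m %% d * d ^ m + d ^ m)).
    by rewrite ltn_add2l ltn_mod expn_gt0 d0.
  by rewrite addnC -mulSn leq_mul2r ltn_mod d0 orbT.
case: m {IH} => [|m]; rewrite ?expn0 ?exp0n // ?muln0 //.
by rewrite divn1 !modn0 modn1 muln1 addn0.
Qed.

End Radix.

(** * Exponent vectors, the set Omega' and its lexicographic order *)

Section Exponents.

Variables (m d : nat).
Hypotheses (m_gt0 : 0 < m) (d_gt0 : 0 < d).

Definition exponents : {set m.+1.-tuple 'I_d.+1} :=
  [set a : m.+1.-tuple 'I_d.+1 | \sum_(i < m.+1) tnth a i == d]%SET.

Definition pure_power (i : 'I_m.+1) : m.+1.-tuple 'I_d.+1 :=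
  [tuple if j == i then ord_max else ord0 | j < m.+1].

Lemma pure_powerE i j : tnth (pure_power i) j = (if j == i then d else 0) :> nat.
Proof. by rewrite tnth_mktuple; case: eqP. Qed.

Lemma pure_power_exponents i : pure_power i \in exponents.
Proof.
rewrite inE (bigD1 i) // pure_powerE eqxx big1 => [|j ji].
  by rewrite /= addn0.
by rewrite pure_powerE (negbTE ji).
Qed.

Lemma exponents_pure_power a i : a \in exponents -> tnth a i = d :> nat ->
  a = pure_power i.
Proof.
rewrite inE (bigD1 i) //= => /eqP aS ai; apply: eq_from_tnth => j; apply: ord_inj.
rewrite pure_powerE; have [->//|ji] := eqVneq j i.
move/eqP: aS; rewrite ai -[X in _ == X]addn0 eqn_add2l (bigD1 j) // addn_eq0.
by case/andP=> /eqP.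
Qed.

Lemma card_exponents : #|exponents| = 'C(d + m, m).
Proof.
rewrite addnC -card_ord_partitions; apply: eq_card => a.
by rewrite !inE big_tuple.
Qed.

Lemma Omega'_exponents : Omega' d m \subset exponents.
Proof. by apply/fintype.subsetP => a; rewrite !inE => /andP[]. Qed.

(** An entry equal to [d] exhausts the sum and forces all other entries to be 0. *)
Lemma exponents_notin_Omega' : exponents :\: Omega' d m =
  [set pure_power i | i in [set i : 'I_m.+1 | 0 < i < m]]%SET.
Proof.
apply/setP => a; apply/idP/imsetP => [|[i]].
  rewrite finset.in_setD => /andP[aO aE]; move: aO (aE); rewrite !inE => aO aE'.
  move: aO; rewrite aE' /= negb_forall => /existsP[i].
  rewrite negb_imply negbK => /andP[im /eqP ai].
  by exists i; rewrite ?inE // (exponents_pure_power aE ai).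
rewrite inE => im ->; rewrite finset.in_setD pure_power_exponents andbT inE negb_and.
by apply/orP; right; apply/forallPn; exists i; rewrite im /= pure_powerE !eqxx.
Qed.

Lemma pure_power_inj : injective pure_power.
Proof.
move=> i j /(congr1 (fun a => nat_of_ord (tnth a i))); rewrite !pure_powerE eqxx.
by case: eqP => // _ d0; have := d_gt0; rewrite d0.
Qed.

Lemma card_exponents_notin_Omega' : #|exponents :\: Omega' d m| = m - 1.
Proof.
rewrite exponents_notin_Omega' card_imset; last exact: pure_power_inj.
have -> : [set i : 'I_m.+1 | 0 < i < m]%SET = (~: [set ord0; ord_max])%SET.
  apply/setP => i; rewrite !inE negb_or -!val_eqE /= -lt0n.
  by rewrite [i < m]ltn_neqAle -[i <= m]ltnS ltn_ord andbT.
by rewrite cardsCs finset.setCK cards2 card_ord -val_eqE /= neq_ltn m_gt0 subSS.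
Qed.

Lemma card_Omega' : #|Omega' d m| = 'C(d + m, m) - (m - 1).
Proof.
rewrite -card_exponents -card_exponents_notin_Omega'.
by rewrite cardsDS ?Omega'_exponents // subKn // subset_leq_card ?Omega'_exponents.
Qed.

Definition tuple_value (a : m.+1.-tuple 'I_d.+1) :=
  radix_value d m (fun i => tnth a (inord i)).

Lemma tuple_value_pure_power0 : tuple_value (pure_power ord0) = d ^ m.
Proof.
rewrite -(radix_value_carry d m_gt0); apply: eq_bigr => i _; congr (_ * _).
by rewrite pure_powerE -val_eqE /= inordK // ltnS ltnW.
Qed.

Lemma H'_tuple_value s : H' s d m = tuple_value (omega' s d m).
Proof.
apply: eq_bigr => i _; congr (_ * _); congr (val (tnth _ _)).
by apply: val_inj; rewrite /= inordK // ltnS ltnW.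
Qed.

Lemma lex_ge_refl : reflexive (@lex_ge d m).
Proof. by move=> a; exact: Order.POrderTheory.lexx. Qed.

Lemma lex_ge_trans : transitive (@lex_ge d m).
Proof. by move=> a b c ab bc; apply: Order.POrderTheory.le_trans bc ab. Qed.

Lemma lex_ge_total : total (@lex_ge d m).
Proof. by move=> a b; exact: Order.TotalTheory.le_total. Qed.

Lemma lex_geP (a b : m.+1.-tuple 'I_d.+1) : lex_ge a b -> a = b \/
  exists2 k : 'I_m.+1, forall i : 'I_m.+1, i < k -> tnth b i = tnth a i &
    tnth b k < tnth a k.
Proof.
rewrite /lex_ge Order.POrderTheory.le_eqVlt => /predU1P[->|]; first by left.
by move/ltxi_tuplePlt => [k]; right; exists k.
Qed.

(** Membership in Omega' keeps the digits of [b] after the first one below [d], so [radix_value_lex]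
    applies at the first difference. *)
Lemma tuple_value_homo (a b : m.+1.-tuple 'I_d.+1) : b \in Omega' d m -> lex_ge a b ->
  tuple_value b <= tuple_value a.
Proof.
move=> bO /lex_geP[-> //|[k kab abk]].
have inordE i : i < m -> (inord i : 'I_m.+1) = i :> nat.
  by move=> im; rewrite inordK // ltnS ltnW.
have [km|mk] := ltnP k m.
  apply: ltnW; apply: (@radix_value_lex _ _ k) => //.
  - by move=> i ik; rewrite kab // inordE // (ltn_trans ik).
  - by rewrite inord_val.
  move=> i /andP[ki im]; rewrite ltn_neqAle -ltnS ltn_ord andbT.
  move: bO; rewrite inE => /andP[_ /forallP/(_ (inord i))/implyP]; apply.
  by rewrite inordE // im andbT (leq_ltn_trans _ ki).
(* The first difference is in the last entry, which is not a digit. *)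
apply: radix_value_leq => i im; rewrite kab // inordE //.
exact: leq_trans mk.
Qed.

Definition Omega'_top s := take s (sort (@lex_ge d m) (enum (Omega' d m))).

Lemma Omega'_topE s a : 0 < s <= #|Omega' d m| -> a \in Omega'_top s ->
  lex_ge a (omega' s d m).
Proof.
case/andP=> s0 sO /(nthP [tuple ord0 | i < m.+1])[i].
have sz : size (sort (@lex_ge d m) (enum (Omega' d m))) = #|Omega' d m|.
  by rewrite size_sort -cardE.
rewrite size_takel ?sz // => li <-; rewrite nth_take //.
apply: (sorted_leq_nth lex_ge_trans lex_ge_refl); rewrite ?inE ?sz ?(leq_trans li) //.
- exact: sort_sorted lex_ge_total _.
- by rewrite prednK.
- by rewrite -ltnS prednK.
Qed.

Lemma omega'_in s : 0 < s <= #|Omega' d m| -> omega' s d m \in Omega' d m.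
Proof.
case/andP=> s0 sO; rewrite -mem_enum -(mem_sort (@lex_ge d m)) mem_nth //.
by rewrite size_sort -cardE prednK.
Qed.

(** The first entry of d e_1 is maximal and determines the tuple, so d e_1 is the lexicographic
    maximum. *)
Lemma pure_power0_top s : 0 < s <= #|Omega' d m| -> pure_power ord0 \in Omega'_top s.
Proof.
case/andP=> s0 sO.
have pO : pure_power ord0 \in Omega' d m.
  have := pure_power_exponents ord0; rewrite !inE => ->.
  apply/forallP => i; apply/implyP => /andP[i0 _].
  by rewrite pure_powerE ifN -?val_eqE /= -?lt0n // neq_ltn d_gt0.
have top1 : pure_power ord0 \in Omega'_top 1.
  have sO1 : 0 < 1 <= #|Omega' d m| by rewrite /= (leq_trans _ sO).
  have := omega'_in sO1; set b := omega' 1 d m => bO.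
  have bT : b \in Omega'_top 1.
    rewrite /Omega'_top (take_nth [tuple ord0 | i < m.+1]) ?size_sort -?cardE //.
    by rewrite mem_rcons mem_head.
  suff <- : b = pure_power ord0 by [].
  have : lex_ge b (pure_power ord0).
    move: pO; rewrite -mem_enum -(mem_sort (@lex_ge d m)).
    move/(nthP [tuple ord0 | i < m.+1]).
    case=> i li <-; apply: (sorted_leq_nth lex_ge_trans lex_ge_refl) => //.
      exact: sort_sorted lex_ge_total _.
    exact: leq_ltn_trans li.
  case/lex_geP=> // -[k kab]; rewrite pure_powerE; case: eqP => [_|/eqP k0 _].
    by rewrite ltnNge -ltnS ltn_ord.
  apply: exponents_pure_power; first exact: (fintype.subsetP Omega'_exponents).
  by rewrite -kab ?pure_powerE // lt0n.
apply: mem_subseq top1.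
rewrite /Omega'_top -(subnKC s0) takeD.
exact: prefix_subseq.
Qed.

End Exponents.

(** * The forms F_b and their values at grid points *)

Section GridPolynomials.

Local Open Scope ring_scope.

Variables (K : fieldType) (m d : nat) (a : seq K).
Implicit Types (b c : m.+1.-tuple 'I_d.+1) (x : 'I_m.+1 -> K).

Let iw (i : 'I_m) : 'I_m.+1 := widen_ord (leqnSn m) i.

Lemma dhomog_prod_sum n (I : Type) (s : seq I) (e : I -> nat) (F : I -> {mpoly K[n]}) :
  (forall i, F i \is (e i).-homog) -> \prod_(i <- s) F i \is (\sum_(i <- s) e i)%N.-homog.
Proof.
move=> Fe; elim: s => [|i s IH]; first by rewrite !big_nil dhomog1.
by rewrite !big_cons dhomogM.
Qed.

Definition grid_mpoly b : {mpoly K[m.+1]} :=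
  (\prod_(i < m) \prod_(j < tnth b (iw i)) ('X_(iw i) - a`_j *: 'X_ord_max)) *
    'X_ord_max ^+ tnth b ord_max.

Lemma dhomog_var n (i : 'I_n) : ('X_i : {mpoly K[n]}) \is 1.-homog.
Proof. by rewrite dhomogX /= mdeg1. Qed.

Lemma dhomog_grid_mpoly b : b \in exponents m d -> grid_mpoly b \is d.-homog.
Proof.
rewrite inE big_ord_recr /= => /eqP E; rewrite -[X in X.-homog]E.
apply: dhomogM; last first.
  by rewrite -[X in X.-homog]mul1n; apply: dhomogMn; exact: dhomog_var.
apply: dhomog_prod_sum => i.
rewrite -[X in X.-homog]card_ord -sum1_card; apply: dhomog_prod_sum => j.
by rewrite rpredB ?rpredZ ?dhomog_var.
Qed.

(** For [b] in [exponents] the polynomial is homogeneous of degree [d], so [indhomog] does not fall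
    back on its default. *)
Definition grid_form b : dhomog m.+1 K d := indhomog d (grid_mpoly b).

Lemma meval_grid_form b x : b \in exponents m d ->
  (grid_form b : {mpoly K[m.+1]}).@[x] =
  (\prod_(i < m) \prod_(j < tnth b (iw i)) (x (iw i) - a`_j * x ord_max)) *
    x ord_max ^+ tnth b ord_max.
Proof.
move=> bE; rewrite /grid_form /indhomog /insubd insubT ?dhomog_grid_mpoly //= => _.
rewrite rmorphM rmorph_prod rmorphXn /= mevalXU; congr (_ * _).
apply: eq_bigr => i _; rewrite rmorph_prod; apply: eq_bigr => j _ /=.
by rewrite mevalB mevalZ !mevalXU.
Qed.

(** The vector (a_(e_1), ..., a_(e_m), 1): [insub] fails only at the last index. *)
Definition grid_point (e : 'I_m -> nat) : 'rV[K]_m.+1 :=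
  \row_i (if insub (val i) is Some i' then a`_(e i') else 1).

Lemma grid_point_widen e i : grid_point e 0 (iw i) = a`_(e i).
Proof. by rewrite mxE /= valK. Qed.

Lemma grid_point_max e : grid_point e 0 ord_max = 1.
Proof. by rewrite mxE insubF //= ltnn. Qed.

Lemma grid_point_neq0 e : grid_point e != 0.
Proof.
by apply/eqP => /rowP/(_ ord_max)/eqP; rewrite grid_point_max mxE oner_eq0.
Qed.

Hypotheses (a_uniq : uniq a) (a_size : size a = d.+1).

(** The factor of index (i, j) takes the value a_(e_i) - a_j, which is 0 only for j = e_i, and this
    j occurs exactly when e_i < b_i. *)
Lemma meval_grid_form_point_eq0 b e :
    b \in exponents m d -> (forall i, e i <= d)%N ->
  ((grid_form b : {mpoly K[m.+1]}).@[fun i => grid_point e 0 i] == 0) =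
  [exists i : 'I_m, e i < tnth b (iw i)]%N.
Proof.
move=> bE ed; rewrite meval_grid_form // grid_point_max expr1n mulr1.
rewrite prodf_seq_eq0; apply/hasP/existsP => -[i].
  rewrite mem_index_enum /= => _ /=; rewrite prodf_seq_eq0 => /hasP[j _] /=.
  rewrite grid_point_widen mulr1 subr_eq0 nth_uniq // ?a_size ?ltnS //.
    by move=> /eqP eij; exists i; rewrite eij ltn_ord.
  by rewrite -ltnS (leq_trans (ltn_ord j)) // ltnW.
move=> ei; exists i; rewrite ?mem_index_enum //=.
rewrite prodf_seq_eq0; apply/hasP; exists (Ordinal ei); rewrite ?mem_index_enum //=.
by rewrite grid_point_widen mulr1 subrr.
Qed.

(* Evaluation of the forms at the grid points with the same exponents is
   triangular with respect to the componentwise order. *)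
Lemma grid_forms_free (s : seq (m.+1.-tuple 'I_d.+1)) :
  uniq s -> {subset s <= exponents m d} -> free [seq grid_form b | b <- s].
Proof.
move=> us sE.
pose b0 : m.+1.-tuple 'I_d.+1 := [tuple ord0 | i < m.+1].
(* This weight is strictly monotone for the componentwise order on the first [m] entries, because
   these determine the last entry. *)
pose w b := (\sum_(i < m) tnth b (iw i))%N.
have wlt b c : b \in exponents m d -> c \in exponents m d -> b != c ->
    (forall i, tnth b (iw i) <= tnth c (iw i))%N -> (w b < w c)%N.
  move=> bE cE bc le_bc.
  have /ltn_leqif -> : (w b <= w c ?= iff [forall i, tnth b (iw i) == tnth c (iw i)])%N.
    by apply: leqif_sum => i _; apply/leqif_eq.
  apply: contraNN bc => /forallP eq_bc; apply/eqP/eq_from_tnth => i.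
  have eq_w : w b = w c by apply: eq_bigr => j _; rewrite (eqP (eq_bc j)).
  move: bE cE; rewrite !inE !big_ord_recr /= -/(w b) -/(w c) eq_w.
  move=> /eqP bS /eqP; rewrite -[X in _ = X]bS => /addnI E.
  have [im|mi] := ltnP i m.
    by have /eqP := eq_bc (Ordinal im); congr (tnth b _ = tnth c _); apply: val_inj.
  have -> : i = ord_max.
    by apply: val_inj; apply/eqP; rewrite /= eqn_leq mi -ltnS ltn_ord.
  exact/val_inj/esym.
pose p b := fun i => grid_point (fun j => tnth b (iw j)) 0 i.
have p0 b c : b \in exponents m d -> c \in exponents m d ->
    (grid_form b : {mpoly K[m.+1]}).@[p c] != 0 -> b = c \/ (w b < w c)%N.
  move=> bE cE; rewrite meval_grid_form_point_eq0 => // [|i]; last by rewrite -ltnS.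
  rewrite negb_exists => /forallP le_bc; have [|bc] := eqVneq b c; [by left|right].
  by apply: wlt => // i; rewrite leqNgt.
have ps b : b \in exponents m d -> (grid_form b : {mpoly K[m.+1]}).@[p b] != 0.
  move=> bE; rewrite meval_grid_form_point_eq0 => // [|i]; last by rewrite -ltnS.
  by rewrite negb_exists; apply/forallP => i; rewrite ltnn.
refine (introT (@freeP K _ _ (in_tuple [seq grid_form b | b <- s])) _) => k /= k0 i.
apply/eqP/negPn/negP => ki.
have sz := size_map grid_form s.
pose t (j : 'I_(size [seq grid_form b | b <- s])) := nth b0 s j.
have tE j : t j \in exponents m d by apply/sE/mem_nth; rewrite -sz.
(* At the point of a [t j] of minimal weight among the terms with nonzero coefficient, every other
   term vanishes: a form nonzero there has smaller weight. *)
pose j := [arg min_(j < i | k j != 0) w (t j)].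
have [kj jmin] : k j != 0 /\ forall l, k l != 0 -> (w (t j) <= w (t l))%N.
  by rewrite /j; case: arg_minnP.
move/(congr1 (fun f : dhomog m.+1 K d => (f : {mpoly K[m.+1]}).@[p (t j)])): k0.
rewrite raddf_sum raddf_sum /= meval0 (bigD1 j) // big1 /= => [|l lj].
  rewrite addr0 [X in X.@[_]]mpoly_of_dhomogZ mevalZ (nth_map b0) -?sz // => /eqP.
  by rewrite mulf_eq0 (negbTE kj) (negbTE (ps _ (tE j))).
rewrite [X in X.@[_]]mpoly_of_dhomogZ mevalZ (nth_map b0) -?sz //.
have [->|kl] := eqVneq (k l) 0; first by rewrite mul0r.
have [->|/(p0 _ _ (tE l) (tE j))[tlj|]] :=
  eqVneq (grid_form (t l) : {mpoly K[m.+1]}).@[p (t j)] 0; first by rewrite mulr0.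
  case/eqP: lj; apply/val_inj/eqP.
  have ls (i' : 'I_(size [seq grid_form b | b <- s])) : (i' < size s)%N by rewrite -sz.
  by rewrite -(nth_uniq b0 (ls l) (ls j) us); apply/eqP.
by move=> lt_lj; have := jmin l kl; rewrite leqNgt lt_lj.
Qed.

Lemma zero_locus_span (s : seq (dhomog m.+1 K d)) (v : 'rV[K]_m.+1) (v0 : v != 0) :
  zero_locus <<s>>%VS (line_point v0) <->
  forall f, f \in s -> (f : {mpoly K[m.+1]}).@[fun i => v 0 i] = 0.
Proof.
rewrite zero_locus_line_point; split=> [H f fs|H f fs]; first exact/H/memv_span.
rewrite (coord_span (X := in_tuple s) fs) raddf_sum raddf_sum big1 //= => l _.
by rewrite [X in X.@[_]]mpoly_of_dhomogZ mevalZ H ?mulr0 // mem_nth.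
Qed.

End GridPolynomials.

(** * The zero locus inside the grid, and the lower bound *)

Lemma grid_points_zero_locus (K : fieldType) (m d : nat) (a : seq K)
    (s : seq (m.+1.-tuple 'I_d.+1)) (W := <<[seq grid_form a b | b <- s]>>%VS) :
    {subset s <= exponents m d} ->
    (forall i : 'I_m, pure_power d (widen_ord (leqnSn m) i) \in s) ->
  forall L, zero_locus W L ->
  exists e : {ffun 'I_m -> 'I_d}, L = line_point (grid_point_neq0 a (fun i => e i : nat)).
Proof.
move=> sE sP L; have v0 := projective_vpick_neq0 L.
rewrite -(line_point_vpick v0); set v := vpick _ in v0 *.
move=> /zero_locus_span Hv.
(* For b = d e_i the form is the product of the x_i - a_j x_(m+1) over j < d, so one factor vanishes
   at [v]. *)
have /fin_all_exists[e he] (i : 'I_m) : exists j : 'I_d,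
    (v 0 (widen_ord (leqnSn m) i) = a`_j * v 0 ord_max)%R.
  have := Hv _ (map_f _ (sP i)); rewrite meval_grid_form ?sE // => /eqP.
  have im : ord_max != widen_ord (leqnSn m) i.
    by rewrite -val_eqE /= gtn_eqF.
  rewrite mulf_eq0 pure_powerE (negbTE im) expr0 oner_eq0 orbF.
  rewrite prodf_seq_eq0 => /hasP[i' _] /=; rewrite prodf_seq_eq0 => /hasP[j _] /=.
  have := ltn_ord j; rewrite [X in (_ < X)%N -> _]pure_powerE.
  have [ii jd|//] := eqVneq; rewrite subr_eq0 => /eqP vj.
  by exists (Ordinal jd); exact: etrans (congr1 (v 0%R) (esym ii)) vj.
(* No zero lies at infinity, since every coordinate is a multiple of the last one. *)
have vm0 : v 0%R ord_max != 0%R.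
  apply: contraNneq v0 => vm0; apply/eqP/rowP => i; rewrite mxE.
  have [im|mi] := ltnP i m.
    have -> : i = widen_ord (leqnSn m) (Ordinal im) by apply: val_inj.
    by rewrite he vm0 mulr0.
  suff -> : i = ord_max by [].
  by apply: val_inj; apply/eqP; rewrite /= eqn_leq mi -ltnS ltn_ord.
exists (finfun e); apply: (line_point_scale (c := v 0%R ord_max)).
apply/rowP => i; rewrite mxE; have [im|mi] := ltnP i m.
  have -> : i = widen_ord (leqnSn m) (Ordinal im) by apply: val_inj.
  by rewrite grid_point_widen he ffunE mulrC.
have -> : i = ord_max.
  by apply: val_inj; apply/eqP; rewrite /= eqn_leq mi -ltnS ltn_ord.
by rewrite grid_point_max mulr1.
Qed.

Theorem proposition1p7 (K : closedFieldType) (m d r : nat)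
    (hm : (0 < m)%N) (hd : (0 < d)%N) (hr : (0 < r)%N)
    (hmr : (m <= r)%N) (hrd : (r <= 'C(d + m, m))%N) :
  (H' (r - (m - 1)) d m <= u_max K r d m)%N.
Proof.
set q := r - (m - 1).
have m1r : m - 1 <= r by apply: leq_trans hmr; exact: leq_subr.
have qO : 0 < q <= #|Omega' d m|.
  by rewrite card_Omega' // leq_sub2r // subn_gt0 subn1 prednK ?hmr.
(* The grid uses a_0, ..., a_(d-1); the scalar a_d serves the evaluation points of the independence
   proof, where an entry may equal [d]. *)
have [a ua sa] := closed_field_uniq_seq K d.+1.
pose s := enum (exponents m d :\: Omega' d m) ++ Omega'_top m d q.
have topO b : b \in Omega'_top m d q -> b \in Omega' d m.
  by move/mem_take; rewrite mem_sort mem_enum.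
have us : uniq s.
  rewrite cat_uniq enum_uniq take_uniq ?sort_uniq ?enum_uniq // andbT.
  apply/hasPn => b /topO bO; rewrite mem_enum finset.in_setD bO //.
have sE : {subset s <= exponents m d}.
  move=> b; rewrite mem_cat mem_enum finset.in_setD => /orP[/andP[]//|/topO].
  exact: (fintype.subsetP (Omega'_exponents m d)).
have ss : size s = r.
  rewrite size_cat -cardE card_exponents_notin_Omega' // size_takel; last first.
    by rewrite size_sort -cardE; case/andP: qO.
  by rewrite subnKC.
have sP (i : 'I_m) : pure_power d (widen_ord (leqnSn m) i) \in s.
  rewrite mem_cat; have [i0|i0] := posnP i.
    have -> : widen_ord (leqnSn m) i = ord0 by apply: val_inj.
    by rewrite pure_power0_top ?orbT.
  rewrite mem_enum exponents_notin_Omega' imset_f // inE /= i0 ltn_ord //.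
pose W := <<[seq grid_form a b | b <- s]>>%VS.
have dW : \dim W = r.
  have /eqP := grid_forms_free ua sa us sE.
  by rewrite size_map ss.
have fW : finite_set (zero_locus W).
  pose g (e : {ffun 'I_m -> 'I_d}) := line_point (grid_point_neq0 a (fun i => e i : nat)).
  apply: (@sub_finite_set _ _ (range g)); last exact: finite_image.
  by move=> L /(grid_points_zero_locus sE sP)[e ->]; exists e.
apply: leq_trans (u_max_ge (ex_intro _ W (And3 dW fW erefl))).
set h := H' q d m.
have hE : h = tuple_value (omega' q d m) by exact: H'_tuple_value.
(* The value of the largest element d e_1 is d^m, so each [n < h] is recovered from its [m]
   digits. *)
have h_le : h <= d ^ m.
  rewrite hE -(tuple_value_pure_power0 _ hm) tuple_value_homo ?omega'_in //.
  by apply: Omega'_topE => //; exact: pure_power0_top.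
pose digit n (i : nat) := n %/ d ^ (m - i.+1) %% d.
have digit_lt n i : digit n i < d by rewrite ltn_mod.
have digitK n : n < h -> radix_value d m (digit n) = n.
  by move=> nh; rewrite radix_value_digits modn_small // (leq_trans nh).
pose g (n : 'I_h) := line_point (grid_point_neq0 a (fun i : 'I_m => digit n i)).
have g_inj : injective g.
  move=> n n' gnn'; apply: val_inj; rewrite /= -(digitK n) // -(digitK n') //.
  apply: eq_bigr => i _; congr (_ * _).
  have := congr1 (affine_coordinate ord_max (widen_ord (leqnSn m) i)) gnn'.
  rewrite !affine_coordinate_line_point !grid_point_max !divr1 !grid_point_widen.
  by move/eqP; rewrite nth_uniq ?sa // ?ltnS ?(ltnW (digit_lt _ _)) // => /eqP.
rewrite -{1}[h]card_ord cardE -(size_map g); apply: uniq_leq_size.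
  by rewrite map_inj_uniq ?enum_uniq.
move=> _ /mapP[n _ ->]; rewrite in_fset_set // inE.
apply/zero_locus_span => _ /mapP[b bs ->]; apply/eqP.
rewrite meval_grid_form_point_eq0 ?sE //; last by move=> i; exact/ltnW.
(* If F_b does not vanish at the point of [n], then the digits of [n] dominate [b], and h <= n is to
   be derived. *)
apply: contraLR (ltn_ord n); rewrite negb_exists => /forallP nb.
have {}nb (i : 'I_m) : tnth b (widen_ord (leqnSn m) i) <= digit n i.
  by rewrite leqNgt.
rewrite -leqNgt -[X in _ <= X]digitK //.
move: bs; rewrite mem_cat mem_enum exponents_notin_Omega' // => /orP[/imsetP[i]|bT].
  (* For b = d e_i a digit of [n] would be at least [d]. *)
  rewrite inE => /andP[_ im] Db; have := nb (Ordinal im).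
  have -> : widen_ord (leqnSn m) (Ordinal im) = i by apply: val_inj.
  by rewrite Db pure_powerE eqxx leqNgt digit_lt.
(* For [b] among the [q] largest elements, h is at most the value of [b], which is at most n. *)
apply: (leq_trans (eq_leq hE)).
apply: leq_trans (tuple_value_homo (omega'_in qO) (Omega'_topE qO bT)) _.
apply: radix_value_leq => i im; apply: leq_trans (nb (Ordinal im)).
apply: eq_leq; congr (val (tnth _ _)); apply: val_inj.
by rewrite /= inordK // ltnS ltnW.
Qed.
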